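(* Let $n\ge 1$ and let $K$ be a field such that $\operatorname{char}K=0$ or $\operatorname{char}K\ge n$. Let $\mathcal M$ be a proper $K$-subspace of $\operatorname{Mat}_n(K)$ of codimension less than $n$, and let $\vartheta$ be any of the four types left, right, pre-two-sided, two-sided. Then $\mathcal M$ is a $\vartheta$-Mathieu subspace of $\operatorname{Mat}_n(K)$ if and only if $\operatorname{tr}M=0$ for all $M\in\mathcal M$ and ($\operatorname{char}K\ne n$ or $I_n\notin\mathcal M$).
   Context: $\operatorname{Mat}_n(K)$ is the $K$-algebra of $n\times n$ matrices over $K$ and $I_n$ is the identity matrix. A $K$-subspace $\mathcal M$ of an associative $K$-algebra $\mathcal A$ is called a $\vartheta$-Mathieu subspace of $\mathcal A$ if for all $a,b,c\in\mathcal A$ such that $a^m\in\mathcal M$ for all $m\ge 1$, the following holds: $ba^m\in\mathcal M$ for all sufficiently large $m$ (if $\vartheta$ = left); $a^mc\in\mathcal M$ for all sufficiently large $m$ (if $\vartheta$ = right); $ba^m\in\mathcal M$ and $a^mc\in\mathcal M$ for all sufficiently large $m$ (if $\vartheta$ = pre-two-sided); $ba^mc\in\mathcal M$ for all sufficiently large $m$ (if $\vartheta$ = two-sided). The ''or'' in the claim is inclusive. *)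

(* Defs.v *)
From mathcomp Require Import all_boot all_order all_algebra.

Set Implicit Arguments.
Unset Strict Implicit.
Unset Printing Implicit Defensive.

Import GRing.Theory.
Local Open Scope ring_scope.

Inductive mathieu_type := MLeft | MRight | MPreTwoSided | MTwoSided.

Definition eventually (P : nat -> Prop) : Prop :=
  exists N : nat, forall m : nat, (N <= m)%N -> P m.

Definition mathieu_cond (A : pzRingType) (theta : mathieu_type)
    (V : {pred A}) (a b c : A) : Prop :=
  match theta with
  | MLeft => eventually (fun m => b * a ^+ m \in V)
  | MRight => eventually (fun m => a ^+ m * c \in V)
  | MPreTwoSided =>
      eventually (fun m => b * a ^+ m \in V /\ a ^+ m * c \in V)
  | MTwoSided => eventually (fun m => b * a ^+ m * c \in V)
  end.

Definition mathieu_subspace (K : fieldType) (A : algType K)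
    (theta : mathieu_type) (V : {pred A}) : Prop :=
  submod_closed V /\
  forall a b c : A,
    (forall m : nat, (1 <= m)%N -> a ^+ m \in V) -> mathieu_cond theta V a b c.

Definition codimv (K : fieldType) (vT : vectType K) (U : {vspace vT}) : nat :=
  (\dim {:vT} - \dim U)%N.

(* Main.v *)
(** Let [N] be the matrix size and [W] the orthogonal of [V] for the form
    [tr (X Y)], so that [dim W < N].

    If all powers of [a] lie in [V] and [a] is not nilpotent, the Fitting
    idempotent of [a] is a polynomial in [a] without constant term, hence lies
    in [V]; its rank vanishes in [K], so it is [1] and [char K = N].

    Conversely, let [V] be right Mathieu (transpose for the left case). Every
    idempotent [e] of [V] satisfies [W e = 0], and a block construction shows
    that [V] then has no idempotent other than [0]. Solving
    [tr ((e + (1 - e) S e) W) = 0] for [S] shows that every nonzero subspace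
    [E] is stabilised by some [w] in [W] with nonzero trace on [E]; in
    particular [u] lies in [u W] for every row [u]. Take [u] with [dim (u W)]
    maximal. A perturbation argument shows that any [A] in [W + K 1] with
    [u A = 0] has its image in [u W]. Applied to subspaces [E] that meet [u W]
    in [K u], this produces [1 - phi u] in [W] with [u phi = 0]. Such [u] span,
    and as [dim W < N] these elements are dependent, which forces [phi = 0] for
    one of them: [1] lies in [W], that is, [V] consists of trace zero matrices.
    Maximality is only exploited through pencils of rank [< N], for which [N]
    elements of [K] suffice. *)
Require Import Defs.
From HB Require Import structures.
From mathcomp Require Import all_boot all_order all_algebra.
From mathcomp Require Import zify.
From Stdlib Require Import Classical.

Set Implicit Arguments.
Unset Strict Implicit.
Unset Printing Implicit Defensive.

Import GRing.Theory.
Local Open Scope ring_scope.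

(** * The trace form and linear systems *)

Lemma mxtrace_mulmx_sum (R : comPzRingType) (m n : nat) (A : 'M[R]_(m, n))
    (B : 'M[R]_(n, m)) :
  \tr (A *m B) = \sum_i \sum_j A i j * B j i.
Proof. by apply: eq_bigr => i _; rewrite mxE. Qed.

Lemma mxtrace_mul_mxvec (R : comPzRingType) (m n : nat) (A : 'M[R]_(m, n))
    (B : 'M[R]_(n, m)) :
  \tr (A *m B) = (mxvec A *m (mxvec B^T)^T) 0 0.
Proof.
rewrite mxtrace_mulmx_sum pair_bigA mxE /= (reindex _ (curry_mxvec_bij _ _)).
by apply: eq_bigr => -[i j] _; rewrite /= !mxE !mxvecE mxE.
Qed.

Lemma linear_form_mxtrace (K : fieldType) (m n : nat)
    (h : {linear 'M[K]_(m, n) -> K^o}) :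
  exists w : 'M[K]_(n, m), forall X, h X = \tr (X *m w).
Proof.
exists (\matrix_(i, j) h (delta_mx j i)) => X.
rewrite mxtrace_mulmx_sum [in LHS](matrix_sum_delta X) linear_sum.
apply: eq_bigr => i _; rewrite linear_sum.
by apply: eq_bigr => j _; rewrite linearZ mxE.
Qed.

Definition lincomb (K : fieldType) (d m n : nat) (f : 'I_d -> 'M[K]_(m, n))
    (c : 'rV[K]_d) : 'M[K]_(m, n) :=
  \sum_i c 0 i *: f i.

Definition trace_orth (K : fieldType) (d n : nat) (w : 'I_d -> 'M[K]_n)
    (X : 'M[K]_n) : Prop :=
  forall i, \tr (X *m w i) = 0.

(** The map [\1 - projv V] has kernel [V], so its coordinates in a basis of its image are [codimv V]
    linear forms cutting out [V]; each is the trace against some matrix. *)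
Lemma vspace_trace_orth (K : fieldType) (n : nat) (V : {vspace 'M[K]_n}) :
  exists w : 'I_(codimv V) -> 'M[K]_n,
    forall X, X \in V <-> trace_orth w X.
Proof.
pose p := (\1 - projv V)%VF.
have p0 X : (p X == 0) = (X \in V).
  rewrite /p !lfunE /= lfunE /= lfunE /= subr_eq0 eq_sym; apply/eqP/idP => [<-|/projv_id //].
  exact: memv_proj.
have dimp : \dim (limg p) = codimv V.
  have := limg_ker_dim p fullv.
  rewrite capfv /codimv => <-.
  have -> : lker p = V by apply/vspaceP => X; rewrite memv_ker p0.
  by rewrite addKn.
rewrite -dimp.
pose h (i : 'I_(\dim (limg p))) X := coord (vbasis (limg p)) i (p X).
have hlin i : linear (h i : 'M[K]_n -> K^o).
  by move=> a X Y; rewrite /h !linearP.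
have ex i : exists wi : 'M[K]_n, forall X, h i X == \tr (X *m wi).
  pose hL := HB.pack (h i : _ -> K^o) (GRing.isLinear.Build _ _ _ _ _ (hlin i)) : {linear 'M[K]_n -> K^o}.
  have [wi Hwi] := linear_form_mxtrace hL.
  by exists wi => X; apply/eqP; exact: Hwi.
have [w Hw] : exists w : 'I_(\dim (limg p)) -> 'M[K]_n, forall i X, h i X = \tr (X *m w i).
  have [w Hw] := fin_all_exists ex.
  by exists w => i X; apply/eqP.
exists w => X; split=> [VX i | wX].
  by rewrite -Hw /h (eqP (_ : p X == 0)) ?p0 // linear0.
rewrite -p0 (coord_vbasis (memv_img p (memvf X))).
by rewrite big1 // => i _; rewrite -/(h i X) Hw wX scale0r.
Qed.

(** Fredholm alternative: flattening gives a linear system with rows [mxvec (f i)], solvable once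
    every relation among these rows kills the right-hand side. *)
Lemma trace_fredholm (K : fieldType) (d p q : nat) (f : 'I_d -> 'M[K]_(p, q))
    (g : 'I_d -> K) :
  (forall c : 'rV_d, lincomb f c = 0 -> \sum_i c 0 i * g i = 0) ->
  exists S : 'M[K]_(q, p), forall i, \tr (S *m f i) = g i.
Proof.
move=> fg0.
pose A := \matrix_i mxvec (f i); pose b := \col_i g i.
have Ac c : c *m A = mxvec (lincomb f c).
  rewrite mulmx_sum_row linear_sum; apply: eq_bigr => i _.
  by rewrite rowK linearZ.
have kAb : kermx A *m b = 0.
  apply/row_matrixP => i; rewrite row_mul row0.
  have /fg0 : lincomb f (row i (kermx A)) = 0.
    apply: (can_inj mxvecK); rewrite -Ac linear0.
    by rewrite -row_mul mulmx_ker row0.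
  by move=> E; apply/rowP => j; rewrite !mxE -[RHS]E; apply: eq_bigr => k _; rewrite !mxE.
have /submxP[y Ey] : (b^T <= A^T)%MS.
  rewrite submxE -trmx_eq0 trmx_mul trmxK.
  suff /submxP[z ->] : ((cokermx A^T)^T <= kermx A)%MS by rewrite -mulmxA kAb mulmx0.
  by apply/sub_kermxP/trmx_inj; rewrite trmx_mul trmxK mulmx_coker trmx0.
exists (vec_mx y)^T => i.
rewrite mxtrace_mulC mxtrace_mul_mxvec trmxK vec_mxK.
have := congr1 (fun M : 'rV_d => M 0 i) Ey; rewrite !mxE => ->.
by apply: eq_bigr => j _; rewrite !mxE mulrC.
Qed.

(** The relation [c] makes the [d] equations on [S] dependent, so their rank is below the number
    [p * q] of unknowns. *)
Lemma trace_orth_nonzero (K : fieldType) (d p q : nat)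
    (f : 'I_d -> 'M[K]_(p, q)) (c : 'rV_d) :
  (d <= p * q)%N -> c != 0 -> lincomb f c = 0 ->
  exists2 S : 'M[K]_(q, p), S != 0 & forall i, \tr (S *m f i) = 0.
Proof.
move=> dpq c0 fc0.
pose A := \matrix_i mxvec (f i).
have cA : c *m A = 0.
  rewrite mulmx_sum_row -[RHS](linear0 mxvec) -fc0 linear_sum.
  by apply: eq_bigr => i _; rewrite rowK linearZ.
have rA : (\rank A < d)%N.
  rewrite ltn_neqAle rank_leq_row andbT; apply: contra c0 => fA.
  by rewrite -(inj_eq (row_free_inj (_ : row_free A))) ?cA ?mul0mx.
have /rowV0Pn[y yk y0] : kermx A^T != 0.
  rewrite kermx_eq0 /row_free mxrank_tr; lia.
exists (vec_mx y)^T => [|i].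
  rewrite trmx_eq0; apply: contra y0 => /eqP E.
  by rewrite -[y]vec_mxK E linear0.
rewrite mxtrace_mulC mxtrace_mul_mxvec trmxK vec_mxK.
have /(congr1 trmx) := sub_kermxP yk; rewrite trmx_mul trmxK trmx0.
move=> /(congr1 (fun M : 'cV_d => M i 0)); rewrite !mxE => E; rewrite -[RHS]E.
by apply: eq_bigr => j _; rewrite !mxE.
Qed.

(** * Matrix pencils and traces of idempotents *)

(** One-sided inverses [H] and [G] compress [A] to the identity of size [\rank A] and [B - t *: A]
    to [N - t%:M], which is invertible unless [t] is one of the at most [\rank A] eigenvalues of
    [N]. *)
Lemma rank_pencil (K : fieldType) (m n : nat) (A B : 'M[K]_(m, n)) (s : seq K) :
  uniq s -> (\rank A < size s)%N ->
  exists t, (\rank A <= \rank (B - t *: A)%R)%N.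
Proof.
move=> us rs.
pose G := pinvmx (row_base A); pose H := pinvmx (col_base A).
have rG : row_base A *m G = 1%:M by rewrite mulmxVp // row_base_free.
have cH : H *m col_base A = 1%:M by rewrite mulVpmx // col_base_full.
have HAG : H *m A *m G = 1%:M.
  have -> : H *m A = row_base A by rewrite -[RHS]mul1mx -cH -mulmxA mulmx_base.
  exact: rG.
pose N := H *m B *m G.
have : ~~ all (root (char_poly N)) s.
  apply: contraTN rs => rts; rewrite -leqNgt -ltnS -(size_char_poly N).
  by apply: max_poly_roots rts us; rewrite monic_neq0 ?char_poly_monic.
case/allPn => t _; rewrite -eigenvalue_root_char => nt; exists t.
have fN : row_free (N - t%:M).
  by rewrite -kermx_eq0; move: nt; rewrite /eigenvalue /eigenspace negbK.
have E : N - t%:M = H *m (B - t *: A) *m G.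
  by rewrite mulmxBr mulmxBl -scalemxAr -scalemxAl HAG scalemx1.
rewrite -{1}(eqP fN) E; apply: leq_trans (mxrankM_maxl _ _) (mxrankM_maxr _ _).
Qed.

(** With [e = C R] a full rank factorisation, the outer factors cancel in [C R C R = C R]. *)
Lemma idempotent_base (K : fieldType) (n : nat) (e : 'M[K]_n) :
  e *m e = e -> row_base e *m col_base e = 1%:M.
Proof.
move=> ee; have cH := mulVpmx (col_base_full e).
have rG := mulmxVp (row_base_free e).
have He : pinvmx (col_base e) *m e = row_base e.
  by rewrite -[RHS]mul1mx -cH -mulmxA mulmx_base.
have eG : e *m pinvmx (row_base e) = col_base e.
  by rewrite -[RHS]mulmx1 -rG mulmxA mulmx_base.
by rewrite -He -eG -mulmxA (mulmxA e) ee eG cH.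
Qed.

Lemma mxtrace_idempotent (K : fieldType) (n : nat) (e : 'M[K]_n) :
  e *m e = e -> \tr e = (\rank e)%:R.
Proof.
by move=> ee; rewrite -[in LHS](mulmx_base e) mxtrace_mulC idempotent_base // mxtrace1.
Qed.

(** * Subspaces stable under members of the span [W] of the [w i] *)

Section MatrixFamily.

Variables (K : fieldType) (d n : nat) (w : 'I_d -> 'M[K]_n).

Lemma lincombB c c' : lincomb w (c - c') = lincomb w c - lincomb w c'.
Proof. by rewrite -sumrB; apply: eq_bigr => i _; rewrite !mxE scalerBl. Qed.

Lemma lincombZ a c : lincomb w (a *: c) = a *: lincomb w c.
Proof. by rewrite scaler_sumr; apply: eq_bigr => i _; rewrite !mxE scalerA. Qed.

Lemma mxtrace_lincomb A c : \tr (A *m lincomb w c) = \sum_i c 0 i * \tr (A *m w i).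
Proof.
rewrite mulmx_sumr linear_sum; apply: eq_bigr => i _.
by rewrite -scalemxAr linearZ.
Qed.

(** Its row space is [x W]. *)
Definition orbit_mx (x : 'rV[K]_n) : 'M[K]_(d, n) := \matrix_i (x *m w i).

Lemma mul_orbit_mx c x : c *m orbit_mx x = x *m lincomb w c.
Proof.
rewrite mulmx_sum_row mulmx_sumr; apply: eq_bigr => i _.
by rewrite rowK -scalemxAr.
Qed.

Lemma orbit_mxB x t y : orbit_mx (y - t *: x) = orbit_mx y - t *: orbit_mx x.
Proof. by apply/row_matrixP => i; rewrite [RHS]linearB [in RHS]linearZ /= !rowK mulmxBl scalemxAl. Qed.

Lemma orbit_mxP x y :
  reflect (exists c, y = x *m lincomb w c) (y <= orbit_mx x)%MS.
Proof.
by apply: (iffP submxP) => -[c ->]; exists c; rewrite mul_orbit_mx.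
Qed.

Definition no_idempotent :=
  forall e : 'M[K]_n, e *m e = e -> trace_orth w e -> e = 0.

(** Otherwise every member of [W] stabilising [E] has trace zero on [E]. This is the solvability
    condition for an [S] making [e + (1 - e) S e] orthogonal to [W], and that matrix is a nonzero
    idempotent. *)
Lemma stable_nonzero_trace m (E : 'M[K]_(m, n)) :
  no_idempotent -> E != 0 ->
  exists c, exists2 e : 'M[K]_n, (e :=: E)%MS &
    [/\ e *m e = e, (E *m lincomb w c <= E)%MS & \tr (e *m lincomb w c) != 0].
Proof.
move=> noid E0; pose R := row_base E.
have RP : R *m pinvmx R = 1%:M by rewrite mulmxVp // row_base_free.
pose e := pinvmx R *m R.
have ee : e *m e = e by rewrite /e mulmxA -(mulmxA _ R) RP mulmx1.
have eE : (e :=: E)%MS.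
  apply: eqmx_trans (eq_row_base E); apply/eqmxP; rewrite submxMl.
  by apply/submxP; exists R; rewrite mulmxA RP mul1mx.
have e0 : e != 0 by rewrite -mxrank_eq0 eE mxrank_eq0.
clearbody e.
have e1e : e *m (1%:M - e) = 0 by rewrite mulmxBr mulmx1 ee subrr.
have [[c [stc trc]] | nex] := classic (exists c,
    e *m lincomb w c *m (1%:M - e) = 0 /\ \tr (e *m lincomb w c) <> 0).
  exists c, e => //; split=> //; last exact/eqP.
  rewrite -(eqmxMr _ eE) -eE; apply/submxP; exists (e *m lincomb w c).
  by move/eqP: stc; rewrite mulmxBr mulmx1 subr_eq0 => /eqP.
pose f i := e *m w i *m (1%:M - e).
have fE c : lincomb f c = e *m lincomb w c *m (1%:M - e).
  rewrite mulmx_sumr mulmx_suml; apply: eq_bigr => i _.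
  by rewrite -scalemxAr -scalemxAl.
have [S HS] : exists S, forall i, \tr (S *m f i) = - \tr (e *m w i).
  apply: trace_fredholm => c; rewrite fE => fc0.
  suff : \tr (e *m lincomb w c) = 0.
    under eq_bigr do rewrite mulrN.
    by rewrite sumrN -mxtrace_lincomb => ->; rewrite oppr0.
  by have [//|/eqP trc] := eqVneq (\tr (e *m lincomb w c)) 0; case: nex; exists c.
pose e' := e + (1%:M - e) *m S *m e.
have ee' : e *m e' = e by rewrite mulmxDr ee !mulmxA e1e !mul0mx addr0.
suff e'0 : e' = 0 by case/eqP: e0; rewrite -ee' e'0 mulmx0.
apply: noid => [|i]; first by rewrite [LHS]mulmxDl -(mulmxA _ e e') ee'.
have -> : e' *m w i = e *m w i + (1%:M - e) *m (S *m (e *m w i)).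
  by rewrite [LHS]mulmxDl !mulmxA.
by rewrite linearD /= (mxtrace_mulC (1%:M - e)) -mulmxA -/(f i) HS addrN.
Qed.

(** For a line, a stabilising combination has [u] as eigenvector; the nonzero trace makes the
    eigenvalue invertible. *)
Lemma fixed_by_lincomb (u : 'rV[K]_n) : no_idempotent -> exists c, u *m lincomb w c = u.
Proof.
move=> noid; have [->|u0] := eqVneq u 0; first by exists 0; rewrite mul0mx.
have [c [e eu [_ /sub_rVP[a ua] trc]]] := stable_nonzero_trace noid u0.
have /submxP[v ev] : (e <= u)%MS by rewrite eu.
have a0 : a != 0.
  by apply: contra trc => /eqP a0; rewrite ev -mulmxA ua a0 scale0r mulmx0 linear0.
by exists (a^-1 *: c); rewrite lincombZ -scalemxAr ua scalerA mulVf ?scale1r.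
Qed.

(** * Generic rows and rank one perturbations of the identity *)

Definition generic_row (u : 'rV[K]_n) : Prop :=
  forall x, (\rank (orbit_mx x) <= \rank (orbit_mx u))%N.

Lemma generic_row_exists : exists u, generic_row u.
Proof.
suff H m u : (d - \rank (orbit_mx u) <= m)%N -> exists u, generic_row u.
  exact: (H d 0 (leq_subr _ _)).
elim: m u => [|m IHm] u le_m.
  exists u => x; have := rank_leq_row (orbit_mx x); lia.
have [[x lt_x] | nex] := classic (exists x, \rank (orbit_mx u) < \rank (orbit_mx x))%N.
  by apply: (IHm x); have := rank_leq_row (orbit_mx x); lia.
by exists u => x; rewrite leqNgt; apply/negP => lt_x; apply: nex; exists x.
Qed.

(** Used to build a basis of generic rows: [orbit_mx] is linear in its row, so this is a pencil of
    matrices with [d] rows. *)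
Lemma generic_row_pencil u y (s : seq K) :
  generic_row u -> uniq s -> (d < size s)%N ->
  exists t, generic_row (y - t *: u).
Proof.
move=> gu us ds.
have [|t le_t] := rank_pencil (A := orbit_mx u) (orbit_mx y) us.
  exact: leq_ltn_trans (rank_leq_row _) ds.
exists t => x; apply: leq_trans (gu x) _.
by rewrite orbit_mxB.
Qed.

(* Differentiating [x A \in x W] along [u + t y]; a second vector of the pencil
   replaces the derivative. *)
Lemma generic_row_sub u A (s : seq K) :
  uniq s -> (d < size s)%N -> generic_row u -> u *m A = 0 ->
  (forall x, x *m A <= orbit_mx x)%MS -> (A <= orbit_mx u)%MS.
Proof.
move=> us ds gu uA0 locA; apply: contraT => /row_subPn[i].
set z := row i A => zNu; pose y : 'rV[K]_n := delta_mx 0 i.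
have yA : y *m A = z by rewrite -rowE.
have z0 : z != 0 by apply: contra zNu => /eqP->; rewrite sub0mx.
(* Multiplication by [P] passes to the quotient by the line of [z]. As [z] is outside [u W], the
   rank of [u W] survives. *)
pose P := cokermx z.
have kerP : (kermx P :=: z)%MS.
  apply/eqmxP; rewrite sub_kermx mulmx_coker eqxx andbT.
  by rewrite submxE mulmx_ker.
have rk x : (\rank (orbit_mx x *m P) + \rank (orbit_mx x :&: z)
             = \rank (orbit_mx x))%N.
  by rewrite -(mxrank_mul_ker (orbit_mx x) P) (cap_eqmx (eqmx_refl _) kerP).
have capu : (orbit_mx u :&: z)%MS = 0.
  apply/eqP/rowV0P => v; rewrite sub_capmx => /andP[vu /sub_rVP[a va]].
  have [a0|a0] := eqVneq a 0; first by rewrite va a0 scale0r.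
  case/negP: zNu; suff -> : z = a^-1 *: v by rewrite scalemx_sub.
  by rewrite va scalerA mulVf ?scale1r.
have ru : \rank (orbit_mx u *m P) = \rank (orbit_mx u).
  by rewrite -[RHS]rk capu mxrank0 addn0.
have [|t le_t] := rank_pencil (A := orbit_mx u *m P) (orbit_mx y *m P) us.
  by apply: leq_ltn_trans ds; apply: rank_leq_row.
move: le_t; rewrite scalemxAl -mulmxBl -orbit_mxB ru.
set x := y - t *: u => le_t.
have xA : x *m A = z by rewrite mulmxBl -scalemxAl uA0 scaler0 subr0.
(* Since [z = x A] lies in [x W], the quotient loses a dimension of [x W], which is thus larger than
   [u W]. *)
have : (0 < \rank (orbit_mx x :&: z))%N.
  rewrite lt0n mxrank_eq0; apply/rowV0Pn; exists z => //.
  by rewrite sub_capmx submx_refl -{1}xA locA.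
by have := leq_trans (gu x) le_t; rewrite -(rk x) -{2}[\rank _]addn0 leq_add2l leqNgt => /negbTE->.
Qed.

(** Modular law: [u + X] meets [L] only in the line of [u]. *)
Lemma capmx_direct_sub m1 m2 m3 (L : 'M[K]_(m1, n)) (X : 'M[K]_(m2, n))
    (u : 'rV[K]_n) (Y : 'M[K]_(m3, n)) :
  (X :&: L)%MS = 0 -> (u <= L)%MS -> (Y <= u + X)%MS -> (Y <= L)%MS ->
  (Y <= u)%MS.
Proof.
move=> XL uL /sub_addsmxP[[a b] /= Yab] YL.
suff b0 : b *m X = 0 by rewrite Yab b0 addr0 submxMl.
apply/eqP; rewrite -submx0 -XL sub_capmx submxMl.
have -> : b *m X = Y - a *m u by rewrite Yab addrC addKr.
by rewrite addmx_sub // eqmx_opp mulmx_sub.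
Qed.

(** Let [w] in [W] stabilise [E = u + X] with nonzero trace there. As [E] meets [u W] in [K u],
    [u w = a u]. Then [A = w - a] kills [u], has image in [u W], and so maps [E] into [K u]. Its
    trace on [E] is zero, whence [a] is nonzero and can be scaled to [1]. *)
Lemma stable_flag (u : 'rV[K]_n) (X : 'M[K]_n) (s : seq K) :
  no_idempotent -> uniq s -> (d < size s)%N -> generic_row u -> u != 0 ->
  (X :&: orbit_mx u)%MS = 0 ->
  exists2 c, u *m lincomb w c = u & (X *m (1%:M - lincomb w c) <= u)%MS.
Proof.
move=> noid us ds gu u0 XL.
have locf x : (x <= orbit_mx x)%MS.
  by have [c xc] := fixed_by_lincomb x noid; apply/orbit_mxP; exists c.
have E0 : (u + X)%MS != 0.
  by apply: contra u0 => /eqP E0; rewrite -submx0 -E0 addsmxSl.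
have [c [e eE [ee stc trc]]] := stable_nonzero_trace noid E0.
have uE : (u <= u + X)%MS by rewrite addsmxSl.
have /sub_rVP[a ua] : (u *m lincomb w c <= u)%MS.
  apply: (capmx_direct_sub XL (locf u)).
    by apply: submx_trans stc; apply: submxMr.
  by apply/orbit_mxP; exists c.
pose A := lincomb w c - a%:M.
have uA : u *m A = 0 by rewrite mulmxBr ua mul_mx_scalar subrr.
have AL : (A <= orbit_mx u)%MS.
  apply: (generic_row_sub us ds gu uA) => x.
  rewrite mulmxBr mul_mx_scalar addmx_sub ?eqmx_opp ?scalemx_sub //.
  by apply/orbit_mxP; exists c.
have EA : ((u + X)%MS *m A <= u)%MS.
  apply: (capmx_direct_sub XL (locf u)); last exact: mulmx_sub.
  rewrite mulmxBr mul_mx_scalar addmx_sub ?eqmx_opp ?scalemx_sub //.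
have /submxP[v eAv] : (e *m A <= u)%MS.
  by apply: submx_trans EA; apply: submxMr; rewrite eE.
have tr0 : \tr (e *m A) = 0.
  have /submxP[y uy] : (u <= e)%MS by rewrite eE.
  have uvu : u *m v *m u = 0.
    by rewrite -mulmxA -eAv mulmxA {1}uy -(mulmxA y) ee -uy uA.
  move: uvu; rewrite eAv mxtrace_mulC [u *m v]mx11_scalar mul_scalar_mx.
  by move/eqP; rewrite scaler_eq0 (negbTE u0) orbF => /eqP->; rewrite mxtrace_scalar mul0rn.
have a0 : a != 0.
  apply: contra trc => /eqP a0.
  by rewrite -tr0 /A a0 -scalemx1 scale0r subr0.
exists (a^-1 *: c).
  by rewrite lincombZ -scalemxAr ua scalerA mulVf ?scale1r.
have -> : 1%:M - lincomb w (a^-1 *: c) = - a^-1 *: A.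
  by rewrite lincombZ scaleNr scalerBr scale_scalar_mx mulVf // opprB.
rewrite -scalemxAr scalemx_sub // (submx_trans _ EA) // submxMr //.
exact: addsmxSr.
Qed.

(** Over any field, a space is not the union of two proper subspaces. *)
Lemma exists_row_outside m1 m2 (A : 'M[K]_(m1, n)) (B : 'M[K]_(m2, n)) :
  (\rank A < n)%N -> (\rank B < n)%N ->
  exists2 y : 'rV[K]_n, ~~ (y <= A)%MS & ~~ (y <= B)%MS.
Proof.
have outside m (C : 'M[K]_(m, n)) : (\rank C < n)%N -> exists y : 'rV[K]_n, ~~ (y <= C)%MS.
  rewrite ltnNge col_leq_rank -sub1mx => /row_subPn[i yi].
  by exists (row i 1%:M).
move=> /outside[y yA] /outside[z zB].
have [yB|] := boolP (y <= B)%MS; last by exists y.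
have [zA|] := boolP (z <= A)%MS; last by exists z.
exists (y + z).
  by apply: contra yA => yzA; rewrite -(addrK z y) addmx_sub ?eqmx_opp.
by apply: contra zB => yzB; rewrite -(addKr y z) addmx_sub ?eqmx_opp.
Qed.

Lemma capmx_adjoin m (L : 'M[K]_(m, n)) (X : 'M[K]_n) (y : 'rV[K]_n) :
  (X :&: L)%MS = 0 -> ~~ (y <= X + L)%MS -> ((X + y)%MS :&: L)%MS = 0.
Proof.
move=> XL yXL; apply/eqP/rowV0P => v; rewrite sub_capmx => /andP[].
move=> /sub_addsmxP[[a b] /= vab] vL.
have [b0|b0] := eqVneq (b *m y) 0.
  apply/eqP; rewrite -submx0 -XL sub_capmx vL andbT.
  by rewrite vab b0 addr0 submxMl.
case/negP: yXL; move: b0 vab; rewrite [b]mx11_scalar mul_scalar_mx.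
set t := b 0 0 => ty0 vab.
have t0 : t != 0 by apply: contra ty0 => /eqP->; rewrite scale0r.
have -> : y = t^-1 *: (v - a *m X).
  by rewrite vab addrC addKr scalerA mulVf ?scale1r.
rewrite scalemx_sub // addmx_sub //; first exact: submx_trans vL (addsmxSr _ _).
by rewrite eqmx_opp mulmx_sub // addsmxSl.
Qed.

Lemma lincomb_mul m (a : 'rV_m) (Z : 'M[K]_(m, d)) :
  lincomb w (a *m Z) = lincomb (fun i => lincomb w (row i Z)) a.
Proof.
rewrite [RHS](eq_bigr (fun i => \sum_j (a 0 i * Z i j) *: w j)) => [|i _].
  rewrite exchange_big; apply: eq_bigr => j _.
  by rewrite !mxE scaler_suml.
by rewrite scaler_sumr; apply: eq_bigr => j _; rewrite !mxE scalerA.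
Qed.

(* [X] is enlarged until every combination vanishing on [u] and mapping [X]
   into [K u] has its whole image in [K u]. *)
Lemma rank_one_shift_rec m (u : 'rV[K]_n) (X : 'M[K]_n) (Z : 'M[K]_d)
    (s : seq K) :
  no_idempotent -> uniq s -> (d < size s)%N -> generic_row u -> u != 0 ->
  (X :&: orbit_mx u)%MS = 0 ->
  (\rank X + \rank Z + \rank (orbit_mx u) < n)%N ->
  (forall c, u *m lincomb w c = 0 -> (X *m lincomb w c <= u)%MS -> (c <= Z)%MS) ->
  (\rank Z < m)%N ->
  exists2 c, u *m lincomb w c = u & (1%:M - lincomb w c <= u)%MS.
Proof.
move=> noid us ds gu u0; elim: m X Z => // m IHm X Z XL rk_lt detZ rZ.
have flag := stable_flag noid us ds gu u0.
have rXL : (\rank (X + orbit_mx u)%MS < n)%N.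
  by have := mxrank_adds_leqif X (orbit_mx u) => -[]; lia.
have [Zu|] := boolP [forall i, (lincomb w (row i Z) <= u)%MS]; last first.
  rewrite negb_forall => /existsP[i ciu].
  pose B := kermx (lincomb w (row i Z) *m cokermx u).
  have rB : (\rank B < n)%N.
    rewrite ltnNge col_leq_rank -sub1mx; apply: contra ciu => /sub_kermxP.
    by rewrite mul1mx submxE => ->.
  have [y yXL yB] := exists_row_outside rXL rB.
  (* Adjoining [y] raises the rank of [X] by at most one, while [Z'] loses the offending row of [Z];
     the bound on the sum of ranks persists. *)
  pose Z' := (Z :&: kermx (orbit_mx y *m cokermx u))%MS.
  have ltZ : (\rank Z' < \rank Z)%N.
    apply: rank_ltmx; rewrite /ltmx capmxSl; apply: contra yB => /row_subP/(_ i).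
    rewrite sub_capmx => /andP[_ /sub_kermxP].
    by rewrite mulmxA mul_orbit_mx => yc; apply/sub_kermxP; rewrite mulmxA.
  apply: (IHm (X + y)%MS Z'); first exact: capmx_adjoin.
  - by have := mxrank_adds_leqif X y => -[]; have := rank_leq_row y; lia.
  - move=> c uc; rewrite addsmxMr addsmx_sub => /andP[Xc yc].
    rewrite sub_capmx detZ //=; apply/sub_kermxP.
    by rewrite mulmxA mul_orbit_mx; apply/eqP; rewrite -submxE.
  - exact: leq_trans ltZ _.
have Zsub c : (c <= Z)%MS -> (lincomb w c <= u)%MS.
  move=> /submxP[a ->]; rewrite lincomb_mul summx_sub // => i _.
  by rewrite scalemx_sub // (forallP Zu).
have [c uc Xc] := flag X XL; exists c => //.
(* The flag for [X + y] gives a [c'] with [c - c'] in [Z], so both shifts agree on [y] modulo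
   [u]. *)
have out (y : 'rV_n) : ~~ (y <= X + orbit_mx u)%MS -> (y *m (1%:M - lincomb w c) <= u)%MS.
  move=> yXL; have [c' uc'] := flag _ (capmx_adjoin XL yXL).
  rewrite addsmxMr addsmx_sub => /andP[Xc' yc'].
  have cE : lincomb w (c - c') = (1%:M - lincomb w c') - (1%:M - lincomb w c).
    by rewrite lincombB opprB [RHS]addrC subrKA.
  have /Zsub : (c - c' <= Z)%MS.
    apply: detZ; first by rewrite lincombB mulmxBr uc uc' subrr.
    by rewrite cE mulmxBr addmx_sub ?eqmx_opp.
  rewrite cE => /(mulmx_sub y) yd.
  rewrite -[X in y *m X](subKr (1%:M - lincomb w c')) mulmxBr.
  by rewrite addmx_sub ?eqmx_opp.
(* Rows outside a proper subspace span everything: inside it, [y = (y + y0) - y0]. *)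
have [y0 y0XL _] := exists_row_outside rXL rXL.
apply/row_subP => i; rewrite rowE; set y : 'rV_n := delta_mx 0 i.
have [yXL|] := boolP (y <= X + orbit_mx u)%MS; last exact: out.
rewrite -(addrK y0 y) mulmxBl addmx_sub ?eqmx_opp //; last exact: out.
apply/out; apply: contra y0XL => sXL; rewrite -(addKr y y0).
by rewrite addmx_sub ?eqmx_opp.
Qed.

Lemma rank_one_shift (u : 'rV[K]_n) (s : seq K) :
  no_idempotent -> uniq s -> (d < size s)%N -> generic_row u -> (d < n)%N ->
  exists2 c, u *m lincomb w c = u & (1%:M - lincomb w c <= u)%MS.
Proof.
move=> noid us ds gu dn.
(* If [u] were zero, maximality would make every [x W] zero, against [x] lying in [x W]. *)
have u0 : u != 0.
  apply/eqP => u0; pose x : 'rV[K]_n := const_mx 1.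
  have x0 : x != 0.
    apply/eqP => /rowP/(_ (Ordinal (leq_ltn_trans (leq0n d) dn))).
    by rewrite !mxE; apply/eqP/oner_neq0.
  have [c xc] := fixed_by_lincomb x noid.
  have xL : (x <= orbit_mx x)%MS by apply/orbit_mxP; exists c.
  have := gu x; have -> : orbit_mx u = 0.
    by apply/row_matrixP => i; rewrite rowK u0 mul0mx row0.
  rewrite mxrank0 leqn0 mxrank_eq0 => /eqP Lx0.
  by case/eqP: x0; apply: (submx0null (m2 := d)); rewrite -Lx0.
(* By rank-nullity the initial sum of ranks is [d]. *)
apply: (rank_one_shift_rec (X := 0) (Z := kermx (orbit_mx u)) noid us ds gu u0 _ _ _ (ltnSn _)).
- exact: cap0mx.
- by rewrite mxrank0 add0n mxrank_ker subnK ?rank_leq_row.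
- by move=> c uc _; apply/sub_kermxP; rewrite mul_orbit_mx.
Qed.

(* The rows [u_i] of [B] form a basis of generic rows, and the [n > d]
   combinations [1 - phi_i u_i] are dependent. *)
Lemma lincomb_eq1 (s : seq K) :
  no_idempotent -> uniq s -> (d < size s)%N -> (d < n)%N ->
  exists c, lincomb w c = 1%:M.
Proof.
move=> noid us ds dn.
have [u gu] := generic_row_exists.
have [t gt] := fin_all_exists (fun i : 'I_n =>
  generic_row_pencil (delta_mx 0 i) gu us ds).
pose A := col_mx u (1%:M - \col_i t i *m u).
have fA : row_full A.
  apply/row_fullP; exists (row_mx (\col_i t i) 1%:M).
  by rewrite mul_row_col mul1mx addrC subrK.
have gA i : generic_row (row i A).
  case: (split_ordP i) => j ->; first by rewrite rowKu (ord1 j) row_id.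
  rewrite rowKd linearB /= row1 row_mul; have -> : row j (\col_i t i) = (t j)%:M.
    by apply/matrixP => a b; rewrite !ord1 !mxE.
  by rewrite mul_scalar_mx.
pose B := rowsub (fullrankfun fA) A.
have Bu : B \in unitmx by apply: fullrowsub_unit.
have gB i : generic_row (row i B) by rewrite row_rowsub.
have [c cB /(_ _)/submxP sB] := fin_all_exists2 (fun i =>
  rank_one_shift noid us ds (gB i) dn).
have [phi phiE] := fin_all_exists sB.
have Bphi i : row i B *m phi i = 0.
  have B0 : row i B != 0.
    apply: contraTneq Bu => B0; rewrite -row_free_unit.
    apply/row_freeP => -[D BD]; have := congr1 (row i) BD.
    rewrite row_mul B0 mul0mx => /rowP/(_ i).
    by rewrite !mxE eqxx => /esym/eqP; rewrite oner_eq0.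
  have : row i B *m phi i *m row i B = 0.
    by rewrite -mulmxA -phiE mulmxBr mulmx1 cB subrr.
  rewrite [row i B *m phi i]mx11_scalar mul_scalar_mx => /eqP.
  by rewrite scaler_eq0 (negbTE B0) orbF => /eqP->; rewrite raddf0.
have /rowV0Pn[a /sub_kermxP aC a0] : kermx (\matrix_i c i) != 0.
  rewrite kermx_eq0 /row_free; have := rank_leq_col (\matrix_i c i); lia.
have ac0 : \sum_i a 0 i *: lincomb w (c i) = 0.
  transitivity (lincomb w (a *m \matrix_i c i)).
    by rewrite lincomb_mul; apply: eq_bigr => i _; rewrite rowK.
  by rewrite aC /lincomb big1 // => i _; rewrite mxE scale0r.
pose b := \sum_i a 0 i.
(* Summing [a_i (1 - w_i) = a_i phi_i u_i], where [w_i] is the combination [c i], gives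
   [b = Phi B]. *)
pose Phi := \matrix_(k, i) (phi i k 0 * a 0 i).
have PhiB : Phi *m B = b%:M.
  have <- : \sum_i a 0 i *: (1%:M - lincomb w (c i)) = b%:M.
    under eq_bigr do rewrite scalerBr.
    by rewrite sumrB ac0 subr0 -scaler_suml scalemx1.
  apply/matrixP => k j; rewrite mxE summxE; apply: eq_bigr => i _.
  by rewrite phiE !mxE big_ord1 !mxE mulrAC mulrC mulrA.
have BPhi : B *m Phi = b%:M.
  by rewrite -[LHS](mulmxK Bu) -(mulmxA B) PhiB mul_mx_scalar -scalemxAl mulmxV // scalemx1.
(* The diagonal entries of [B Phi] are [(u_i phi_i) a_i = 0]. *)
have b0 : b = 0.
  pose i := Ordinal (leq_ltn_trans (leq0n d) dn).
  have := congr1 (fun M : 'M_n => M i i) BPhi; rewrite !mxE eqxx mulr1n => <-.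
  have /(congr1 (fun M : 'M_1 => M 0 0 * a 0 i)) := Bphi i.
  rewrite !mxE mul0r mulr_suml => E; rewrite -[RHS]E.
  by apply: eq_bigr => k _; rewrite !mxE mulrA.
have Phi0 : Phi = 0 by rewrite -[Phi](mulmxK Bu) PhiB b0 raddf0 mul0mx.
have [i ai] : exists i, a 0 i != 0 by apply/rV0Pn.
exists (c i); apply/esym/eqP; rewrite -subr_eq0 phiE.
suff -> : phi i = 0 by rewrite mul0mx.
apply/colP => k; have /matrixP/(_ k i) := Phi0; rewrite !mxE => /eqP.
by rewrite mulf_eq0 (negbTE ai) orbF => /eqP.
Qed.

(** * From one-sided ideals generated by idempotents to the identity in [W] *)

(** If the row spaces of the [w i] span everything, [W e = 0] forces [e = 0]. Otherwise let [R] be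
    their proper span. Block idempotents adapted to [R] and a complement, with a free corner [S],
    can be made orthogonal to [W] without being killed by it. *)
Lemma no_idempotent_of_right_ideal :
  (d < n)%N -> (exists i, w i != 0) ->
  (forall e, e *m e = e -> trace_orth w e -> forall i, w i *m e = 0) ->
  no_idempotent.
Proof.
move=> dn [i0 wi0] rid.
pose R := (\sum_i <<w i>>)%MS.
have wR i : (w i <= R)%MS by rewrite -(genmxE (w i)) (sumsmx_sup i).
have Rker m (A : 'M_(n, m)) : (forall i, w i *m A = 0) -> R *m A = 0.
  move=> wA; apply/sub_kermxP/sumsmx_subP => i _.
  by rewrite genmxE; apply/sub_kermxP.
have [fR e ee we|nfR] := boolP (row_full R).
  by apply: (row_full_inj fR); rewrite mulmx0; apply/Rker/rid.
have Rn : (\rank R < n)%N by rewrite ltnNge col_leq_rank.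
have R0 : (0 < \rank R)%N.
  rewrite lt0n mxrank_eq0; apply: contra wi0 => /eqP R0.
  by have := wR i0; rewrite R0 submx0.
pose Q := row_base R; pose V := pinvmx Q.
have QR : (Q :=: R)%MS := eq_row_base R.
have QV : Q *m V = 1%:M by rewrite mulmxVp // row_base_free.
pose Y := col_base (cokermx Q).
have QY : Q *m Y = 0.
  apply: (row_free_inj (row_base_free (cokermx Q))).
  by rewrite mul0mx -mulmxA mulmx_base mulmx_coker.
pose X := pinvmx Y *m (1%:M - V *m Q).
have XY : X *m Y = 1%:M.
  by rewrite -(mulmxA (pinvmx Y)) mulmxBl mul1mx -(mulmxA V) QY mulmx0 subr0 mulVpmx // col_base_full.
have XV : X *m V = 0.
  by rewrite -(mulmxA (pinvmx Y)) mulmxBl mul1mx -(mulmxA V) QV mulmx1 subrr mulmx0.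
have wQ i : exists z, w i = z *m Q by apply/submxP; rewrite QR.
have wY i : w i *m Y = 0 by have [z ->] := wQ i; rewrite -mulmxA QY mulmx0.
have wVQ i : w i *m V *m Q = w i.
  by have [z ->] := wQ i; rewrite -(mulmxA z) QV mulmx1.
clearbody X; clearbody Y; clearbody V; clearbody Q.
pose f i := X *m w i *m V.
(* For [0 < r < n] one has [(n - r) r >= n - 1 >= d]. *)
have dim_le : (d <= \rank (cokermx Q) * \rank R)%N.
  have := mxrank_coker Q; rewrite QR => ->; nia.
have trf S i : \tr (V *m S *m X *m w i) = \tr (S *m f i).
  by rewrite -!mulmxA mxtrace_mulC /f !mulmxA.
(* If the corners [f i] are dependent, a nonzero [S] orthogonal to them perturbs the projector
   [Y X]; if independent, [S] corrects the traces for the projector [V Q]. *)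
have [[c c0 fc0] | nex] := classic (exists2 c : 'rV_d, c != 0 & lincomb f c = 0).
  have [S S0 Sf] := trace_orth_nonzero dim_le c0 fc0.
  pose e := Y *m X + V *m S *m X.
  case/eqP: S0; suff SX : S *m X = 0 by rewrite -[S]mulmx1 -XY mulmxA SX mul0mx.
  rewrite -[S *m X]mul1mx -QV -mulmxA (mulmxA V).
  suff RT : R *m (V *m S *m X) = 0.
    by apply/sub_kermxP; rewrite QR; apply/sub_kermxP.
  apply: Rker => i.
  have -> : w i *m (V *m S *m X) = w i *m e by rewrite mulmxDr (mulmxA _ Y) wY mul0mx add0r.
  apply: rid => [|j].
    rewrite mulmxDl !mulmxDr !mulmxA -!(mulmxA _ X) XY XV.
    by rewrite !mulmx1 !mulmx0 !mul0mx !addr0.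
  by rewrite mulmxDl linearD /= trf Sf addr0 mxtrace_mulC mulmxA wY mul0mx linear0.
have [|S Sf] := trace_fredholm (f := f) (g := fun i => - \tr (w i)).
  move=> c fc0; have [->|c0] := eqVneq c 0; last by case: nex; exists c.
  by rewrite big1 // => i _; rewrite mxE mul0r.
pose e := V *m Q + V *m S *m X.
have we i : w i *m e = 0.
  apply: rid => [|j].
    rewrite mulmxDl !mulmxDr !mulmxA -!(mulmxA _ X) XV -!(mulmxA _ Q V) QV.
    by rewrite !mulmx1 !mulmx0 !mul0mx !addr0.
  by rewrite mulmxDl linearD /= trf Sf mxtrace_mulC mulmxA wVQ subrr.
case/eqP: wi0.
have /(congr1 (fun M => M *m V *m Q)) := we i0.
by rewrite !mulmxDr !mulmxA wVQ !mulmxDl -!(mulmxA _ X) XV mulmx0 !mul0mx addr0 wVQ.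
Qed.
End MatrixFamily.

Lemma right_ideals_lincomb_eq1 (K : fieldType) (d n : nat)
    (w : 'I_d -> 'M[K]_n) (s : seq K) :
  (d < n)%N -> uniq s -> (d < size s)%N -> (exists i, w i != 0) ->
  (forall e, e *m e = e -> trace_orth w e -> forall b, trace_orth w (e *m b)) ->
  exists c, lincomb w c = 1%:M.
Proof.
move=> dn us ds w0 rid; apply: (lincomb_eq1 _ us ds dn).
apply: (no_idempotent_of_right_ideal dn w0) => e ee oe i.
apply/matrixP => k j; rewrite [RHS]mxE.
(* The matrix unit reads off entry [(k, j)] of [w i *m e]. *)
have := rid e ee oe (delta_mx j k) i.
rewrite mxtrace_mulC mulmxA (mxtrace_mulC _ (delta_mx j k)).
move: (w i *m e) => M; rewrite mxtrace_mulmx_sum (bigD1 j) //= (bigD1 k) //=.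
rewrite mxE !eqxx mul1r big1 ?addr0 => [|a /negbTE ak]; last first.
  by rewrite mxE ak andbF mul0r.
rewrite big1 ?addr0 // => a /negbTE aj.
by rewrite big1 // => b _; rewrite mxE aj mul0r.
Qed.

(** Transposition exchanges left and right ideals and fixes the identity. *)
Lemma left_ideals_lincomb_eq1 (K : fieldType) (d n : nat)
    (w : 'I_d -> 'M[K]_n) (s : seq K) :
  (d < n)%N -> uniq s -> (d < size s)%N -> (exists i, w i != 0) ->
  (forall e, e *m e = e -> trace_orth w e -> forall b, trace_orth w (b *m e)) ->
  exists c, lincomb w c = 1%:M.
Proof.
move=> dn us ds [i wi] lid; pose wt i := (w i)^T.
have orthT X : trace_orth wt X <-> trace_orth w X^T.
  by split=> oX j; rewrite -(oX j) -mxtrace_tr trmx_mul ?trmxK mxtrace_mulC.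
have [c cE] : exists c, lincomb wt c = 1%:M.
  apply: right_ideals_lincomb_eq1 dn us ds _ _ => [|e ee /orthT oe b].
    by exists i; rewrite /wt trmx_eq0.
  by apply/orthT; rewrite trmx_mul; apply: lid oe _; rewrite -trmx_mul ee.
exists c; apply: trmx_inj; rewrite trmx1 -cE linear_sum.
by apply: eq_bigr => j _; rewrite linearZ.
Qed.

(** * Fitting idempotents and characteristic *)

(** Write the characteristic polynomial as [g X^k] with [g(0)] nonzero and [u X^(k+1) + v g = 1].
    For [e = (u X^(k+1))(a)], [e (1 - e)] is a multiple of it at [a], hence zero. *)
Lemma fitting_idempotent (K : fieldType) (n : nat) (a : 'M[K]_n.+1) :
  (exists k, a ^+ k = 0) \/
  exists q, let e := horner_mx a ('X * q) in e * e = e /\ e != 0.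
Proof.
have [k [g g0 chiE]] := multiplicity_XsubC (char_poly a) 0.
rewrite monic_neq0 ?char_poly_monic //= in g0; rewrite subr0 in chiE.
have chi0 p : horner_mx a (p * (g * 'X^k)) = 0.
  by rewrite -chiE rmorphM /= Cayley_Hamilton mulr0.
(* The exponent [k.+1] removes the constant term even when [k = 0]. *)
have /Bezout_eq1_coprimepP[[u v] /= uv1] : coprimep 'X^(k.+1) g.
  by rewrite coprimep_expl // coprimep_sym -['X]subr0 coprimep_XsubC.
pose e := horner_mx a (u * 'X^(k.+1)).
have [e0|e0] := eqVneq e 0; [left; exists k | right; exists (u * 'X^k)].
  have : horner_mx a ('X^k * (u * 'X^(k.+1) + v * g)) = 0.
    rewrite mulrDr (mulrC 'X^k (v * g)) -(mulrA v) rmorphD /= chi0 addr0.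
    by rewrite rmorphM /= -/e e0 mulr0.
  by rewrite uv1 mulr1 rmorphXn /= horner_mx_X.
have -> : 'X * (u * 'X^k) = u * 'X^(k.+1) by rewrite mulrCA exprS.
split=> //; apply/eqP; rewrite -subr_eq0 -/e -{3}[e]mulr1 -mulrBr.
have -> : e - 1 = - horner_mx a (v * g).
  by rewrite -[1](rmorph1 (horner_mx a)) -uv1 rmorphD /= -/e opprD addNKr.
rewrite mulrN -rmorphM /= oppr_eq0 exprSr.
have -> : u * ('X^k * 'X) * (v * g) = (u * 'X * v) * (g * 'X^k).
  by rewrite -!mulrA; congr (_ * _); rewrite mulrCA (mulrC 'X^k) -!mulrA.
by rewrite chi0.
Qed.

Lemma horner_mx_mulX_mem (K : fieldType) (n : nat) (V : {vspace 'M[K]_n.+1})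
    (a : 'M[K]_n.+1) (q : {poly K}) :
  (forall m, (1 <= m)%N -> a ^+ m \in V) -> horner_mx a ('X * q) \in V.
Proof.
move=> aV; rewrite -[q]coefK poly_def mulr_sumr rmorph_sum /=.
apply: memv_suml => i _; rewrite -scalerAr -exprS linearZ /= rmorphXn /=.
by rewrite horner_mx_X memvZ ?aV.
Qed.

(** A characteristic [p] would divide [r], so [p <= r <= n.+1 <= p]. *)
Lemma natr_eq0_bounded (K : fieldType) (n r : nat) :
  [pchar K] =i pred0 \/ (exists2 p : nat, p \in [pchar K] & (n.+1 <= p)%N) ->
  (0 < r <= n.+1)%N -> r%:R = 0 :> K -> r = n.+1 /\ n.+1 \in [pchar K].
Proof.
move=> [/pcharf0P K0 | [p pK np]] /andP[r0 rn] /eqP rK.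
  by rewrite K0 in rK; rewrite (eqP rK) in r0.
have pr := dvdn_leq r0 (etrans (dvdn_pcharf pK r) rK).
have <- : p = n.+1 by apply/eqP; rewrite eqn_leq np (leq_trans pr rn).
by split=> //; apply/eqP; rewrite eqn_leq pr (leq_trans rn np).
Qed.

(** * Mathieu subspaces *)

Lemma eventually_exists (P : nat -> Prop) :
  eventually P -> exists2 m, (1 <= m)%N & P m.
Proof. by case=> N PN; exists (maxn N 1); [exact: leq_maxr | exact/PN/leq_maxl]. Qed.

(** Positive powers of [e] equal [e], so the eventual condition holds for [e] itself; in the
    two-sided case the right factor is set to [1]. *)
Lemma mathieu_idempotent (K : fieldType) (A : algType K) (theta : mathieu_type)
    (V : {pred A}) :
  mathieu_subspace theta V ->
  (forall e, e \in V -> e * e = e -> forall b, b * e \in V) \/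
  (forall e, e \in V -> e * e = e -> forall c, e * c \in V).
Proof.
move=> [_ mV].
have expe (e : A) m : e * e = e -> (1 <= m)%N -> e ^+ m = e.
  move=> ee; case: m => // m _; elim: m => [|m IHm]; first by rewrite expr1.
  by rewrite exprS IHm ee.
have cond e : e \in V -> e * e = e -> forall b c, mathieu_cond theta V e b c.
  by move=> eV ee b c; apply: mV => m m1; rewrite expe.
case: theta mV cond => _ cond; [left | right | left | left] => e eV ee b.
- by have /eventually_exists[m m1] := cond e eV ee b 1; rewrite expe.
- by have /eventually_exists[m m1] := cond e eV ee 1 b; rewrite expe.
- by have /eventually_exists[m m1 []] := cond e eV ee b 1; rewrite expe.
- by have /eventually_exists[m m1] := cond e eV ee b 1; rewrite expe // mulr1.
Qed.

Lemma mathieu_subspace_nilpotent (K : fieldType) (A : algType K)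
    (theta : mathieu_type) (V : {pred A}) :
  submod_closed V ->
  (forall a, (forall m, (1 <= m)%N -> a ^+ m \in V) -> exists k, a ^+ k = 0) ->
  mathieu_subspace theta V.
Proof.
move=> sV nilV; split=> // a b c /nilV[k ak].
have a0 m : (k <= m)%N -> a ^+ m = 0.
  by move=> km; rewrite -(subnK km) exprD ak mulr0.
have V0 := sV.1.
by case: theta; exists k => m /a0->; rewrite ?mulr0 ?mul0r.
Qed.

(* The matrix size is n.+1, which encodes that it is at least 1; the library
   gives square matrices an algebra structure only for sizes of this form. *)
Theorem corollary1p5 (n : nat) (K : fieldType)
    (charK : [pchar K] =i pred0 \/
             (exists2 p : nat, p \in [pchar K] & (n.+1 <= p)%N))
    (V : {vspace 'M[K]_n.+1})
    (V_proper : V != fullv) (V_codim : (codimv V < n.+1)%N)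
    (theta : mathieu_type) :
  mathieu_subspace theta (mem V : {pred 'M[K]_n.+1}) <->
  (forall X : 'M[K]_n.+1, X \in V -> \tr X = 0) /\
  (n.+1 \notin [pchar K] \/ 1%:M \notin V).
Proof.
split=> [mV | [trV charV]]; last first.
  apply: mathieu_subspace_nilpotent => [|a aV].
    by split=> [|t X Y XV YV]; rewrite ?mem0v ?memvD ?memvZ.
  have [//|[q [ee e0]]] := fitting_idempotent a.
  set e := horner_mx a ('X * q) in ee e0.
  have eV : e \in V by apply: horner_mx_mulX_mem.
  (* The rank of [e] equals its trace in [K], hence vanishes there; so [e] has full rank and, being
     idempotent, is [1]. *)
  have [||re pK] := natr_eq0_bounded charK (r := \rank e).
  - by rewrite lt0n mxrank_eq0 e0 rank_leq_row.
  - by rewrite -mxtrace_idempotent // trV.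
  case: charV; rewrite ?pK // => /negP[].
  have ue : e \in unitmx by rewrite -row_full_unit /row_full re.
  by rewrite -(mulVmx ue) -{2}ee mulKmx.
have [w wP] := vspace_trace_orth V.
have w0 : exists i, w i != 0.
  have [//|nex] := classic (exists i, w i != 0).
  case/negP: V_proper; rewrite eqEsubv subvf /=.
  apply/subvP => X _; apply/wP => i.
  have [->|wi] := eqVneq (w i) 0; first by rewrite mulmx0 linear0.
  by case: nex; exists i.
(* The hypothesis on the characteristic makes [0, ..., n] distinct in [K], giving more scalars than
   the codimension. *)
pose s : seq K := [seq i%:R | i <- iota 0 n.+1].
have us : uniq s.
  rewrite map_inj_in_uniq ?iota_uniq // => i j.
  wlog ij : i j / (i <= j)%N.
    by move=> H; case: (leqP i j) => [|/ltnW] ij iI jI E; [exact: H | apply/esym/H].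
  rewrite !mem_iota /= => iI jI E; apply/eqP; rewrite eqn_leq ij leqNgt.
  apply/negP => ltij.
  have [||re _] := natr_eq0_bounded charK (r := j - i).
  - by rewrite subn_gt0 ltij; lia.
  - by rewrite natrB // E subrr.
  lia.
have ds : (codimv V < size s)%N by rewrite size_map size_iota.
have [c cE] : exists c, lincomb w c = 1%:M.
  case: (mathieu_idempotent mV) => idV.
    apply: left_ideals_lincomb_eq1 V_codim us ds w0 _ => e ee /wP eV b.
    exact/wP/idV.
  apply: right_ideals_lincomb_eq1 V_codim us ds w0 _ => e ee /wP eV b.
  exact/wP/idV.
split=> [X /wP oX | ].
  rewrite -[X]mulmx1 -cE mxtrace_lincomb big1 // => i _.
  by rewrite oX mulr0.
(* The one-sided ideal generated by the idempotent [1] is the whole algebra. *)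
right; apply: contra V_proper => IV; rewrite eqEsubv subvf /=.
apply/subvP => X _.
by case: (mathieu_idempotent mV) => /(_ 1 IV (mulr1 1) X); rewrite ?mulr1 ?mul1r.
Qed.
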